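(* Let $G$ be a finite simple graph with at least three vertices that is not isomorphic to the complete graph $K_4$. Then $G$ is primarily orientable if and only if the following two conditions hold: (1) $G$ is connected; (2) for every s-module $S$ of $G$, we have $d_G(S) \geq \log_2(|S|)$.
   Context: Graphs are finite, with no loops or multiple edges. An orientation of a graph $G$ is a digraph on $V(G)$ obtained by replacing each edge $\{u,v\}$ of $G$ by exactly one of the arcs $(u,v)$, $(v,u)$ (and having no other arcs). For a graph (resp. digraph) $G$, a subset $M \subseteq V(G)$ is a module of $G$ if for all $x,y \in M$ and all $v \in V(G)\setminus M$: $\{v,x\}$ is an edge iff $\{v,y\}$ is an edge (resp. $(v,x)$ is an arc iff $(v,y)$ is an arc, and $(x,v)$ is an arc iff $(y,v)$ is an arc). The modules $\varnothing$, $V(G)$ and the singletons are trivial. A graph or digraph is prime if it has at least three vertices and all its modules are trivial. A graph is primarily orientable if it admits an orientation that is prime. A stable set of $G$ is a subset $S \subseteq V(G)$ with $|S| \geq 2$ such that no two vertices of $S$ are adjacent. An s-module of $G$ is a module of $G$ that is also a stable set. For a nonempty module $M$ of a graph $G$, its neighbourhood $N_G(M)$ is the set of vertices $v \in V(G)\setminus M$ adjacent to some (equivalently, every) vertex of $M$, and $d_G(M) = |N_G(M)|$. *)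

(* Defs.v *)
From mathcomp Require Import all_boot.
From Stdlib Require Reals.

Set Implicit Arguments.
Unset Strict Implicit.
Unset Printing Implicit Defensive.

Record sgraph := SGraph {
  vertex :> finType;
  adj : rel vertex;
  adj_sym : symmetric adj;
  adj_irr : irreflexive adj }.

Notation "x -- y" := (adj x y) (at level 30, no associativity).

Definition isomorphic (G H : sgraph) : Prop :=
  exists2 f : G -> H, bijective f & forall x y : G, f x -- f y = x -- y.

Fact complete_sym n : symmetric (fun i j : 'I_n => i != j).
Proof. by move=> i j; rewrite eq_sym. Qed.

Fact complete_irr n : irreflexive (fun i j : 'I_n => i != j).
Proof. by move=> i; rewrite eqxx. Qed.

Definition complete_graph (n : nat) : sgraph :=
  SGraph (@complete_sym n) (@complete_irr n).

(* The connectedness of the graph with no vertex is irrelevant here: graphs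
   will have at least three vertices. *)
Definition connected (G : sgraph) : Prop :=
  forall x y : G, connect (@adj G) x y.

(* A digraph on V is given by its arc relation. *)
Definition digraph_module (V : finType) (arc : rel V) (M : {set V}) : Prop :=
  forall x y v : V, x \in M -> y \in M -> v \notin M ->
    arc v x = arc v y /\ arc x v = arc y v.

Definition graph_module (G : sgraph) (M : {set G}) : Prop :=
  forall x y v : G, x \in M -> y \in M -> v \notin M -> v -- x = v -- y.

Definition trivial_set (V : finType) (M : {set V}) : Prop :=
  M = set0 \/ M = [set: V] \/ exists x : V, M = [set x].

Definition prime_digraph (V : finType) (arc : rel V) : Prop :=
  3 <= #|V| /\
  forall M : {set V}, digraph_module arc M -> trivial_set M.

(* The first clause also excludes loops, since adjacency is irreflexive; the
   exclusive or says that exactly one of the two arcs is present. *)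
Definition orientation (G : sgraph) (arc : rel G) : Prop :=
  (forall u v : G, arc u v -> u -- v) /\
  (forall u v : G, u -- v -> arc u v (+) arc v u).

Definition primarily_orientable (G : sgraph) : Prop :=
  exists2 arc : rel G, orientation arc & prime_digraph arc.

Definition stable_set (G : sgraph) (S : {set G}) : Prop :=
  2 <= #|S| /\ forall x y : G, x \in S -> y \in S -> ~~ x -- y.

Definition s_module (G : sgraph) (S : {set G}) : Prop :=
  graph_module S /\ stable_set S.

Definition neighbourhood (G : sgraph) (M : {set G}) : {set G} :=
  [set v | v \notin M & [exists x in M, v -- x]].

Definition degree (G : sgraph) (M : {set G}) : nat := #|neighbourhood M|.

Import Rdefinitions.

Definition log2 (x : R) : R := (Rpower.ln x / Rpower.ln 2)%R.

(* Main.v *)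
(** Necessity: a component and its complement are modules of any orientation;
and if an s-module has more than [2 ^ d] vertices, two of them receive the same
arcs from the [d] neighbours and form a module.

Sufficiency goes by induction on the number of vertices. If [G - x] has a prime
orientation, at most [|F| + 2 |T| + 2] of the [2 ^ d(x)] orientations of the
edges at [x] fail to extend it to a prime one, where [F] and [T] are the sets of
false and true twins of [x], and the last [2] counts only if [x] is universal;
the hypotheses on [G] make this number less than [2 ^ d(x)] unless [G] is
complete with at most four vertices. A vertex [x] such
that [G - x] inherits the hypotheses is found in a largest class of false twins
or, if there are no false twins or some [G - y] is complete, among the noncut
vertices. Complete graphs on 3 and 5 vertices get a circular tournament. *)

Require Import Defs.
From mathcomp Require Import all_boot zify.
From Stdlib Require Reals Lra.

Set Implicit Arguments.
Unset Strict Implicit.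
Unset Printing Implicit Defensive.

(** * Induced subgraphs: neighbourhoods, false twins, connectivity *)

Section InducedSubgraphs.
Variable G : sgraph.
Implicit Types (A B C M P : {set G}) (u v w x y : G).

Lemma adjC x y : x -- y = y -- x.
Proof. exact: adj_sym. Qed.

Lemma adjxx x : x -- x = false.
Proof. exact: adj_irr. Qed.

Lemma adj_neq x y : x -- y -> x != y.
Proof. by apply: contraTneq => ->; rewrite adjxx. Qed.

Definition nbhd A x := [set v in A | x -- v].

(* The classes with at least two elements are the maximal s-modules of [G[A]],
   and [nbhd A x] is then the neighbourhood of the class of [x]. *)
Definition twins A x := [set u in A | nbhd A u == nbhd A x].

Definition twin_bounded A :=
  forall x, x \in A -> #|twins A x| <= 2 ^ #|nbhd A x|.

(** Connectivity is expressed by cuts rather than paths: when a vertex is added or deleted, only the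
    cut has to be adjusted. *)
Definition conn A := forall C a b,
  a \in A -> b \in A -> a \in C -> b \notin C ->
  exists u v, [/\ u \in A, v \in A, u \in C, v \notin C & u -- v].

Definition complete A := {in A &, forall u v, u != v -> u -- v}.

Definition dmodule_in A (arc : rel G) M :=
  forall x y v, x \in M -> y \in M -> v \in A -> v \notin M ->
    arc v x = arc v y /\ arc x v = arc y v.

(** There is no lower bound on [#|A|], so every arc relation is prime on two vertices; noncomplete
    graphs on three vertices are reached from there. *)
Definition prime_in A (arc : rel G) :=
  forall M, M \subset A -> dmodule_in A arc M -> #|M| <= 1 \/ M = A.

Lemma nbhdD1 A x u : nbhd (A :\ x) u = nbhd A u :\ x.
Proof. by apply/setP=> v; rewrite !inE andbA. Qed.

Lemma twins_nadj A x u v : u \in twins A x -> v \in twins A x -> u -- v = false.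
Proof.
rewrite !inE => /andP[uA /eqP eu] /andP[vA /eqP ev].
by have /setP/(_ v) := etrans eu (esym ev); rewrite !inE vA adjxx.
Qed.

Lemma complete_sub A B : B \subset A -> complete A -> complete B.
Proof. by move=> /subsetP sBA cA u v /sBA uA /sBA; apply: cA. Qed.

Lemma complete_conn A : complete A -> conn A.
Proof.
move=> cA C a b aA bA aC bC; exists a, b; split=> //; apply: cA => //.
by apply: contraNneq bC => <-.
Qed.

Lemma complete_twins A x : complete A -> #|twins A x| <= 1.
Proof.
move=> cA; apply/card_le1_eqP => u v uT vT; apply/eqP.
have := twins_nadj uT vT; move: uT vT; rewrite !inE => /andP[uA _] /andP[vA _].
by apply: contraFT; rewrite eq_sym; apply: cA.
Qed.

Lemma complete_twin_bounded A : complete A -> twin_bounded A.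
Proof.
by move=> cA x _; apply: leq_trans (complete_twins _ cA) _; rewrite expn_gt0.
Qed.

Lemma conn_nbhd A x y : conn A -> x \in A -> y \in A -> y != x -> 0 < #|nbhd A x|.
Proof.
move=> cA xA yA yx.
have [||u [v [uA vA]]] := cA [set x] x y xA yA; rewrite ?inE //.
by move=> /eqP-> _ xv; apply/card_gt0P; exists v; rewrite inE vA.
Qed.

(** * Vertex deletions that preserve the hypotheses *)

Lemma conn_add B b v : conn B -> b \in B -> b -- v -> conn (v |: B).
Proof.
move=> cB bB bv C p q pB qB pC qC.
(* Either the cut splits [B], which is connected, or it separates [v] from [B] and the edge between
   [b] and [v] crosses it. *)
have [|all_in] := boolP [exists x in B, x \notin C]; last first.
  have sBC x : x \in B -> x \in C.
    by move=> xB; apply: contraNT all_in => xC; apply/existsP; exists x; rewrite xB.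
  exists b, v; split; rewrite ?inE ?bB ?eqxx ?orbT ?(sBC b) //.
  move: qB; rewrite !inE => /orP[/eqP<- //|/sBC qC'].
  by rewrite qC' in qC.
move=> /existsP[x /andP[xB xC]].
have [|all_out] := boolP [exists y in B, y \in C]; last first.
  have sBC y : y \in B -> y \notin C.
    by move=> yB; apply: contraNN all_out => yC; apply/existsP; exists y; rewrite yB.
  exists v, b; split; rewrite ?inE ?bB ?eqxx ?orbT ?(sBC b) //; last by rewrite adjC.
  move: pB; rewrite !inE => /orP[/eqP<- //|/sBC pC'].
  by rewrite pC in pC'.
move=> /existsP[y /andP[yB yC]].
have [s [t [sB tB sC tC st]]] := cB _ _ _ yB xB yC xC.
by exists s, t; split; rewrite ?inE ?sB ?tB ?orbT.
Qed.

(** As long as [B] is not [A], an edge leaves [B] inside [A] and its outer end can be absorbed. The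
    last vertex absorbed is the one to delete. *)
Lemma conn_grow A B : conn A -> conn B -> B != set0 -> B \proper A ->
  exists v, [/\ v \in A, conn (A :\ v) & B \subset A :\ v].
Proof.
move=> cA; have [n] := ubnP #|A :\: B|; elim: n B => // n IHn B leBn cB B0 BA.
have [/subsetP sBA [z zA zB]] := properP BA; have [a aB] := set0Pn _ B0.
have [b [v [bA vA bB vB bv]]] := cA B a z (sBA a aB) zA aB zB.
have cvB := conn_add cB bB bv.
have [eA|neq] := eqVneq (v |: B) A.
  have eB : A :\ v = B by rewrite -eA setU1K.
  by exists v; rewrite eB.
have [||||w [wA cw sw]] := IHn (v |: B) => //.
- by move: leBn; rewrite (cardsD1 v (_ :\: _)) inE vA vB setDDl setUC.
- by apply/set0Pn; exists v; rewrite setU11.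
- by rewrite properEneq neq subUset sub1set vA; apply/subsetP.
by exists w; split=> //; apply: subset_trans sw; apply: subsetUr.
Qed.

(* Grow an induced path on three vertices to a connected set missing only one
   vertex: its nonadjacent ends survive. *)
Lemma noncut_vertex A a c :
  conn A -> 3 < #|A| -> a \in A -> c \in A -> a != c -> ~~ a -- c ->
  exists v, [/\ v \in A, conn (A :\ v) & ~ complete (A :\ v)].
Proof.
move=> cA A4 aA cAA ac nac.
(* An edge leaving the closed neighbourhood of [a] gives the induced path [a], [u], [w]. *)
have [||u [w [uA wA]]] := cA (a |: nbhd A a) a c aA cAA.
- by rewrite setU11.
- by rewrite !inE negb_or eq_sym ac cAA.
rewrite !inE uA wA negb_or /= => uC /andP[wa naw] uw.
have au : a -- u.
  by case/orP: uC uw => [/eqP->|//]; rewrite (negPf naw).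
have [|||v [vA cv /subsetP sv]] := @conn_grow A (w |: (a |: [set u])) cA.
- apply: (@conn_add _ u) => //; last by rewrite !inE eqxx orbT.
  apply: (@conn_add _ u); rewrite ?inE ?eqxx //; last by rewrite adjC.
  by move=> C p q; rewrite !inE => /eqP-> /eqP-> uC' /negP.
- by apply/set0Pn; exists w; rewrite setU11.
- rewrite properEcard !subUset !sub1set wA aA uA /=.
  by rewrite (leq_ltn_trans _ A4) // !cardsU1 cards1; do 2 case: (_ \notin _).
exists v; split=> // cplv.
have /cplv : a \in A :\ v by apply: sv; rewrite !inE eqxx orbT.
move=> /(_ w); rewrite sv ?setU11 // eq_sym wa (negPf naw).
by move=> /(_ isT isT).
Qed.

(* A twin [y] of [x] left behind replaces [x] in every cut; a class adjacent to
   [x] has at most [t] elements and keeps [t - 1] neighbours, where [t] is the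
   size of the class of [x], and [t <= 2 ^ (t - 1)]. *)
Lemma twins_delete A x y : conn A -> twin_bounded A ->
    x \in A -> y \in twins A x -> y != x ->
    (forall u, u \in A -> #|twins A u| <= #|twins A x|) ->
  conn (A :\ x) /\ twin_bounded (A :\ x).
Proof.
move=> cA tA xA; rewrite inE => /andP[yA /eqP exy] yx maxx.
have xyE u : u \in A -> x -- u = y -- u.
  by move=> uA; have /setP/(_ u) := exy; rewrite !inE uA.
split.
  move=> C p q; rewrite !inE => /andP[px pA] /andP[qx qA] pC qC.
  have [||u [v [uA vA]]] := cA (if y \in C then x |: C else C :\ x) p q pA qA.
  - by case: ifP; rewrite !inE ?px pC ?orbT.
  - by case: ifP; rewrite !inE (negPf qx) (negPf qC).
  have [->|ux] := eqVneq u x.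
    case: ifP => yC; rewrite !inE eqxx //= negb_or => _ /andP[vx vC] xv.
    by exists y, v; split; rewrite ?inE ?yx ?vx -?xyE.
  have [->|vx] := eqVneq v x.
    case: ifP => yC; rewrite !inE eqxx //= => /andP[_ uC] _ xv.
    by exists u, y; split; rewrite ?inE ?yx ?ux ?yC // adjC -xyE // adjC.
  case: ifP => yC; rewrite !inE (negPf ux) (negPf vx) /= => uC vC uv;
    by exists u, v; split; rewrite // !inE ?ux ?vx.
move=> u /setD1P[ux uA].
(* Twins in [A :\ x] agree on [y], hence also on its twin [x]. *)
have sT : twins (A :\ x) u \subset twins A u.
  apply/subsetP=> v; rewrite !inE !nbhdD1 => /andP[/andP[vx vA] /eqP e].
  rewrite vA; apply/eqP/setP=> w.
  have [->|wx] := eqVneq w x; last by have /setP/(_ w) := e; rewrite !inE wx.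
  have /setP/(_ y) := e; rewrite !inE yx xA yA /=.
  by rewrite ![_ -- y]adjC -!xyE // ![x -- _]adjC.
have [xu|nxu] := boolP (x -- u); last first.
  rewrite (leq_trans (subset_leq_card sT)) // (leq_trans (tA u uA)) //.
  rewrite leq_exp2l // nbhdD1 subset_leq_card //; apply/subsetP=> w.
  rewrite !inE => /andP[wA uw]; rewrite wA uw !andbT.
  by apply: contraNneq nxu => <-; rewrite adjC.
rewrite (leq_trans (subset_leq_card sT)) // (leq_trans (maxx u uA)) //.
rewrite (cardsD1 x) inE xA eqxx add1n (leq_trans (ltn_expl _ (isT : 1 < 2))) //.
rewrite leq_exp2l // subset_leq_card //; apply/subsetP=> w.
rewrite !inE => /andP[wx /andP[wA /eqP e]]; rewrite wx wA /=.
by have /setP/(_ u) := e; rewrite !inE uA xu adjC.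
Qed.

(** Connectivity gives every vertex a neighbour, and a class of two is allowed one neighbour. *)
Lemma small_twin_bounded A : conn A -> 1 < #|A| ->
  (forall u, u \in A -> #|twins A u| <= 2) -> twin_bounded A.
Proof.
move=> cA A1 small u uA; apply: (leq_trans (small u uA)).
have /card_gt0P[y] : 0 < #|A :\ u| by move: A1; rewrite (cardsD1 u) uA.
case/setD1P=> yu yA.
by rewrite -[X in X <= _](expn1 2) leq_exp2l // (conn_nbhd cA uA yA).
Qed.

(** The neighbourhoods in [A] of the members of one class of [A :\ v] can differ only in [v], so
    there are at most two of them, and distinct vertices of [A] have distinct neighbourhoods. *)
Lemma twin_free_delete A v u : (forall w, w \in A -> #|twins A w| <= 1) ->
  #|twins (A :\ v) u| <= 2.
Proof.
move=> free.
rewrite -(@card_in_imset _ _ (nbhd A)); last first.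
  move=> p q; rewrite !inE => /andP[/andP[_ pA] _] /andP[/andP[_ qA] _] e.
  by apply: (card_le1_eqP (free q qA)); rewrite !inE ?pA ?qA ?e ?eqxx.
apply: (@leq_trans #|[set nbhd (A :\ v) u; v |: nbhd (A :\ v) u]|); last first.
  by rewrite cards2; case: (_ != _).
apply/subset_leq_card/subsetP=> _ /imsetP[p + ->].
rewrite inE => /andP[_ /eqP <-]; rewrite nbhdD1 !inE.
have [vp|vp] := boolP (v \in nbhd A p); first by rewrite setD1K // eqxx orbT.
have -> : nbhd A p :\ v = nbhd A p.
  by apply/setDidPl; rewrite disjoint_sym disjoints1.
by rewrite eqxx.
Qed.

(** A class is independent, so it meets the clique [A :\ x] in at most one vertex; [x] itself may be
    a second member. *)
Lemma near_complete_delete A x v u : complete (A :\ x) ->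
  #|twins (A :\ v) u| <= 2.
Proof.
move=> cA; rewrite (cardsD1 x) -[2]/(1 + 1); apply: leq_add; first by case: (_ \in _).
apply/card_le1_eqP => p q /setD1P[px pT] /setD1P[qx qT].
apply/eqP; have := twins_nadj pT qT; move: pT qT; rewrite !inE.
move=> /andP[/andP[_ pA] _] /andP[/andP[_ qA] _].
by apply: contraFT; rewrite eq_sym; apply: cA; rewrite !inE ?px ?qx.
Qed.

(** * Orientations and their extension by one vertex *)

Lemma orientation_sym arc u v : orientation arc -> u -- v ->
  arc v u = ~~ arc u v.
Proof. by move=> [_ xarc] /xarc; case: (arc u v); case: (arc v u). Qed.

Lemma orientationN arc u v : orientation arc -> u -- v = false -> arc u v = false.
Proof. by move=> [sarc _]; apply: contraFF; apply: sarc. Qed.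

(* [P] is the set of out-neighbours of [x]. *)
Definition reorient (arc : rel G) x P : rel G := fun u v =>
  if u == x then x -- v && (v \in P)
  else if v == x then u -- x && (u \notin P) else arc u v.

Lemma reorient_orientation arc x P : orientation arc -> orientation (reorient arc x P).
Proof.
move=> [sarc xarc]; split=> u v; rewrite /reorient.
  by case: eqVneq => [->|_]; [case/andP|case: eqVneq => [->|_]; [case/andP|apply: sarc]].
case: (eqVneq u x) => [->|ux] uv.
  by rewrite (adjC v) uv eq_sym (negPf (adj_neq uv)) /=; case: (_ \in _).
case: (eqVneq v x) uv => [->|vx] uv; last exact: xarc.
by rewrite (adjC x) uv /=; case: (_ \in _).
Qed.

Definition true_twins A x := [set u in nbhd A x | nbhd A u :\ x == nbhd A x :\ u].

(** Let [d] be the degree of [x]. A false twin excludes both true twins and universality, and the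
    twin bound suffices. Otherwise, if [x] is not universal, some neighbour is no true twin, and
    [2 (d - 1) < 2 ^ d]. If [x] is universal, [2 d + 2 < 2 ^ d] for [d >= 4], and for [d = 3]
    noncompleteness leaves at most two true twins. *)
Lemma pattern_count A x : conn A -> twin_bounded A -> x \in A -> 1 < #|A| ->
    (exists2 y, y \in A :\ x & ~~ x -- y) \/ (3 < #|A| /\ ~ (complete A /\ #|A| = 4)) ->
  #|twins A x :\ x| + 2 * #|true_twins A x| + 2 * (A :\ x \subset nbhd A x)
    < 2 ^ #|nbhd A x|.
Proof.
move=> cA tA xA A1 hyp.
have sTN : true_twins A x \subset nbhd A x.
  by apply/subsetP => u; rewrite inE => /andP[].
have [F0|[u uF]] := set_0Vmem (twins A x :\ x); last first.
  move: (uF) => /setD1P[ux]; rewrite inE => /andP[uA /eqP eu].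
  have nxu : u \notin nbhd A x by rewrite -eu inE adjxx andbF.
  have -> : A :\ x \subset nbhd A x = false.
    by apply/subsetP => /(_ u); rewrite inE in_set1 ux uA (negPf nxu) => /(_ isT).
  have -> : true_twins A x = set0.
    apply/setP => w; rewrite in_set0 inE; apply/negP => /andP[wN /eqP ew].
    have := wN; rewrite -eu inE => /andP[wA uw].
    have : u \in nbhd A w :\ x by rewrite !inE ux uA adjC.
    by rewrite ew !inE => /andP[_ /andP[_ xu]]; move: nxu; rewrite inE uA xu.
  rewrite cards0 !addn0; apply: leq_trans (tA x xA).
  by rewrite (cardsD1 x (twins A x)) inE xA eqxx.
rewrite F0 cards0 add0n.
have [univ|] := boolP (A :\ x \subset nbhd A x); last first.
  case/subsetPn => z zA zN; rewrite addn0.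
  have zx : z != x by case/setD1P: zA.
  have zAA : z \in A by case/setD1P: zA.
  (* An edge leaving [x] and its true twins ends in a neighbour of [x] that is not a true twin. *)
  have [||u [v [uA vA]]] := cA (x |: true_twins A x) x z xA zAA.
  - exact: setU11.
  - by rewrite in_setU1 (negPf zx); apply: contraNN zN; apply: (subsetP sTN).
  rewrite !in_setU1 negb_or => uC /andP[vx vT] uv.
  have vN : v \in nbhd A x.
    case/orP: uC => [/eqP <-|]; first by rewrite inE vA.
    rewrite inE => /andP[_ /eqP eu].
    have : v \in nbhd A u :\ x by rewrite !inE vx vA.
    by rewrite eu => /setD1P[].
  have : #|true_twins A x| < #|nbhd A x|.
    by apply: proper_card; apply/properP; split=> //; exists v.
  case: #|nbhd A x| => // d; rewrite ltnS => le.
  rewrite expnS ltn_pmul2l //; exact: leq_ltn_trans le (ltn_expl _ _).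
have eN : nbhd A x = A :\ x.
  apply/eqP; rewrite eqEsubset univ andbT; apply/subsetP => w.
  by rewrite !inE => /andP[-> /adj_neq]; rewrite eq_sym => ->.
have dA : #|A| = #|nbhd A x|.+1 by rewrite eN (cardsD1 x) xA.
case: hyp => [[y yA nxy]|[A4 nK4]].
  by move: (subsetP univ y yA); rewrite inE (negPf nxy) andbF.
have [A5|] := leqP 5 #|A|.
  apply: (@leq_ltn_trans (2 * #|nbhd A x| + 2)).
    by rewrite leq_add2r leq_mul2l subset_leq_card.
  move: A5; rewrite dA; case: #|nbhd A x| => [|[|[|[|d]]]] // _.
  elim: d => // d IHd; rewrite expnS; lia.
move=> A5; have d3 : #|nbhd A x| = 3 by lia.
suff : #|true_twins A x| < 3 by rewrite d3; lia.
rewrite ltnNge; apply/negP => T3; apply: nK4; split; last by lia.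
have eT : true_twins A x = A :\ x.
  by rewrite -eN; apply/eqP; rewrite eqEcard sTN d3.
move=> u v uA vA uv.
have [ux|ux] := eqVneq u x.
  have : v \in nbhd A x by rewrite eN !inE vA -ux eq_sym uv.
  by rewrite inE ux => /andP[].
have [vx|vx] := eqVneq v x.
  have : u \in nbhd A x by rewrite eN !inE uA -vx uv.
  by rewrite inE vx adjC => /andP[].
have : u \in true_twins A x by rewrite eT !inE ux.
rewrite inE => /andP[_ /eqP eu].
have : v \in nbhd A u :\ x by rewrite eu eN !inE vx vA eq_sym uv.
by rewrite !inE => /andP[_ /andP[]].
Qed.

(** A module of the extension, with [x] removed, is a module on [A :\ x], hence has at most one
    element or is everything. The only nontrivial modules to avoid are thus [A :\ x] and the pairs
    containing [x]; each forces one of the patterns counted above. *)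
Lemma prime_extend A x arc : conn A -> twin_bounded A -> x \in A -> 1 < #|A| ->
    (exists2 y, y \in A :\ x & ~~ x -- y) \/ (3 < #|A| /\ ~ (complete A /\ #|A| = 4)) ->
    orientation arc -> prime_in (A :\ x) arc ->
  exists2 arc', orientation arc' & prime_in A arc'.
Proof.
move=> cA tA xA A1 hyp oarc parc; have cnt := pattern_count cA tA xA A1 hyp.
set N := nbhd A x in cnt.
(* If [{x, u}] is a module, [P] agrees with [Q u] except possibly at [u]; a true twin [u] thus
   excludes two patterns, a false twin only one. *)
pose Q u := [set v in A :\ x | arc u v].
(* The patterns [P] that create a module [A :\ x] or [{x, u}]. *)
pose bad := Q @: (twins A x :\ x) :|: Q @: true_twins A x
  :|: (fun u => u |: Q u) @: true_twins A x
  :|: (if A :\ x \subset N then [set set0; N] else set0).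
have [P PN Pbad] : exists2 P : {set G}, P \subset N & P \notin bad.
  have : ~~ (powerset N \subset bad).
    apply: contraTN cnt => /subset_leq_card; rewrite card_powerset -leqNgt.
    move=> /leq_trans; apply.
    rewrite mul2n -addnn addnA; apply: leq_trans (leq_card_setU _ _) _.
    apply: leq_add; last first.
      by case: ifP; rewrite ?cards0 // cards2; case: (_ != _).
    apply: leq_trans (leq_card_setU _ _) _; apply: leq_add (leq_imset_card _ _).
    by apply: leq_trans (leq_card_setU _ _) _; apply: leq_add; apply: leq_imset_card.
  by case/subsetPn => P; rewrite inE => ? ?; exists P.
exists (reorient arc x P); first exact: reorient_orientation.
have outE v : reorient arc x P x v = (v \in P).
  rewrite /reorient eqxx; apply: andb_idl => /(subsetP PN).
  by rewrite inE => /andP[].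
have inE' v : v != x -> reorient arc x P v x = x -- v && (v \notin P).
  by rewrite /reorient eqxx adjC => /negPf->.
have offE u v : u != x -> v != x -> reorient arc x P u v = arc u v.
  by rewrite /reorient => /negPf-> /negPf->.
move=> M MA modM.
have modM' : dmodule_in (A :\ x) arc (M :\ x).
  move=> u w v /setD1P[ux uM] /setD1P[wx wM] /setD1P[vx vA].
  rewrite !inE vx /= => vM; have := modM u w v uM wM vA vM.
  by rewrite !offE.
have sM' : M :\ x \subset A :\ x by apply: setSD.
have [xM|xM] := boolP (x \in M); last first.
  have eM : M :\ x = M by apply/setDidPl; rewrite disjoint_sym disjoints1.
  rewrite eM in modM' sM'.
  have [|eMA] := parc M sM' modM'; first by left.
  have /card_gt0P[z zA] : 0 < #|A :\ x| by move: A1; rewrite (cardsD1 x A) xA.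
  have zx : z != x by case/setD1P: zA.
  (* Here [M] is [A :\ x], whose vertices all look alike from [x]: so [x] is universal, and [P] is
     empty or [N]. *)
  have uni v : v \in A :\ x -> (v \in P) = (z \in P) /\ (x -- v = x -- z).
    move=> vA; have vx : v != x by case/setD1P: vA.
    have [] := modM v z x; rewrite ?eMA //; first by rewrite !inE eqxx.
    rewrite !outE !inE' // => e1; rewrite -e1.
    have [vP|vP] := boolP (v \in P); last by rewrite !andbT.
    have := subsetP PN v vP; have := subsetP PN z; rewrite -e1 vP => /(_ isT).
    by rewrite !inE => /andP[_ ->] /andP[_ ->].
  have xz : x -- z.
    have [y yN] : exists y, y \in N.
      by apply/card_gt0P; apply: (conn_nbhd cA xA (y := z)) => //; case/setD1P: zA.
    have yA : y \in A :\ x.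
      move: yN; rewrite !inE => /andP[-> /adj_neq]; by rewrite eq_sym => ->.
    by have [_ <-] := uni y yA; move: yN; rewrite inE => /andP[].
  have AN : A :\ x \subset N.
    apply/subsetP => v vA; have [_ e] := uni v vA.
    by rewrite inE e xz andbT; case/setD1P: vA.
  case/negP: Pbad; rewrite /bad AN !in_setU /= !in_set1; apply/orP; right.
  have [zP|zP] := boolP (z \in P).
    apply/orP; right; rewrite eqEsubset PN; apply/subsetP => v vN.
    have vA : v \in A :\ x.
      move: vN; rewrite !inE => /andP[-> /adj_neq]; by rewrite eq_sym => ->.
    by have [->] := uni v vA.
  apply/orP; left; apply/set0Pn => -[v vP].
  have vA : v \in A :\ x.
    have := subsetP PN v vP.
    rewrite !inE => /andP[-> /adj_neq]; by rewrite eq_sym => ->.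
  by have [e _] := uni v vA; rewrite -e vP in zP.
have [|eM] := parc _ sM' modM'; last first.
  by right; rewrite -(setD1K xM) eM setD1K.
rewrite leq_eqVlt ltnS leqn0 cards_eq0 => /orP[/cards1P[u eM]|/eqP M0]; last first.
  by left; rewrite (cardsD1 x) xM M0 cards0.
have /setD1P[ux uM] : u \in M :\ x by rewrite eM set11.
have uA := subsetP MA u uM.
(* Here [M] is [{x, u}]: the two vertices have the same neighbours and the same out-neighbours
   elsewhere. *)
have dist v : v \in A -> v != x -> v != u ->
    (v \in P) = arc u v /\ x -- v = u -- v.
  move=> vA vx vu; have vM : v \notin M.
    have : v \notin M :\ x by rewrite eM inE.
    by rewrite !inE vx.
  have [] := modM x u v xM uM vA vM.
  rewrite outE inE' // !offE // => e1 e2; split=> //.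
  have [vP|vP] := boolP (v \in P).
    have := subsetP PN v vP; rewrite inE => /andP[_ ->].
    by rewrite e2 in vP; case: oarc => s _; rewrite (s _ _ vP).
  move: e1; rewrite vP andbT => ->; case: (boolP (u -- v)) => uv.
    by rewrite (orientation_sym oarc uv) -e2 vP.
  by rewrite (orientationN oarc) // adjC; apply/negbTE.
have QE v : v != u -> (v \in P) = (v \in Q u).
  move=> vu; rewrite 3!inE.
  have [vx|vx] /= := eqVneq v x.
    by rewrite vx; apply/negP => /(subsetP PN); rewrite inE adjxx andbF.
  have [vA|vA] /= := boolP (v \in A); first by have [] := dist v vA vx vu.
  by apply/negP => /(subsetP PN); rewrite inE (negPf vA).
have uQ : u \notin Q u by rewrite inE (orientationN oarc) ?adjxx ?andbF.
have NE v : v != x -> v != u -> (v \in nbhd A u) = (v \in N).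
  move=> vx vu; rewrite !inE; case: (boolP (v \in A)) => //= vA.
  by have [_ ->] := dist v vA vx vu.
have xN : x \notin N by rewrite inE adjxx andbF.
case/negP: Pbad; rewrite /bad !in_setU.
have [uN|uN] := boolP (u \in N).
  have uT : u \in true_twins A x.
    rewrite inE uN; apply/eqP/setP => v; rewrite !in_setD1 -/N.
    have [->|vx] /= := eqVneq v x; first by rewrite (negPf xN) andbF.
    have [->|vu] /= := eqVneq v u; first by rewrite inE adjxx andbF.
    exact: NE.
  have [uP|uP] := boolP (u \in P).
    apply/orP; left; apply/orP; right; apply/imsetP; exists u => //.
    apply/setP => v; rewrite in_setU1; have [->//|vu] := eqVneq v u; exact: QE.
  apply/orP; left; apply/orP; left; apply/orP; right; apply/imsetP; exists u => //.
  apply/setP => v; have [->|vu] := eqVneq v u; last exact: QE.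
  by rewrite (negPf uP) (negPf uQ).
apply/orP; left; apply/orP; left; apply/orP; left; apply/imsetP; exists u.
  rewrite in_setD1 ux inE uA; apply/eqP/setP => v.
  have [->|vx] := eqVneq v x.
    by rewrite -/N (negPf xN); move: uN; rewrite !inE uA xA /= adjC => /negPf.
  have [->|vu] := eqVneq v u; last exact: NE.
  by rewrite -/N (negPf uN) inE adjxx andbF.
apply/setP => v; have [->|vu] := eqVneq v u; last exact: QE.
by rewrite (negPf uQ); apply/negP => /(subsetP PN); rewrite (negPf uN).
Qed.

(** * Circular tournaments on three and five vertices *)

Lemma orientation_index (s : seq G) : (forall u, u \in s) ->
  orientation (fun u v : G =>
    u -- v && ((index u s < index v s) == odd (index u s + index v s))).
Proof.
move=> ss; split=> [u v /andP[]//|u v uv].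
(* Exchanging [u] and [v] reverses the comparison and keeps the parity of the sum. *)
rewrite (adjC v u) uv /= (addnC (index v s)).
have := contra_neq (@index_inj _ u s u v (ss u) (ss v)) (adj_neq uv).
by case: ltngtP => // _ _; case: odd.
Qed.

(* In a tournament on [0, .., m - 1] with [m] odd, [i -> j] iff [j - i] is odd
   modulo [m]; this reads [(i < j) == odd (i + j)]. *)
Definition circular_module m (b : nat -> bool) :=
  all (fun i => all (fun j => all (fun k => [&& b i, b j & ~~ b k] ==>
    (((k < i) == odd (k + i)) == ((k < j) == odd (k + j))))
    (iota 0 m)) (iota 0 m)) (iota 0 m).

Lemma circular_prime m b : (m == 3) || (m == 5) -> circular_module m b ->
  all b (iota 0 m) \/ {in iota 0 m &, forall i j, b i -> b j -> i = j}.
Proof.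
move=> m35 h.
(* In boolean form the claim is decided by evaluation over the at most [2 ^ 5] values of [b] on the
   indices. *)
suff : all b (iota 0 m) || all (fun i => all (fun j => b i && b j ==> (i == j))
  (iota 0 m)) (iota 0 m).
  case/orP => [|/allP h']; [by left|right=> i j im jm bi bj].
  by have /allP/(_ j jm) := h' i im; rewrite bi bj => /eqP.
move: h; case/orP: m35 => /eqP->; rewrite /circular_module /=.
  by case: (b 0); case: (b 1); case: (b 2).
by case: (b 0); case: (b 1); case: (b 2); case: (b 3); case: (b 4).
Qed.

Lemma prime_complete_small A : complete A -> (#|A| == 3) || (#|A| == 5) ->
  exists2 arc : rel G, orientation arc & prime_in A arc.
Proof.
(* Listing [A] first gives its vertices the indices below [#|A|]. *)
move=> cA A35; pose s := enum A ++ enum (~: A).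
have ss u : u \in s by rewrite mem_cat !mem_enum inE orbN.
exists (fun u v => u -- v && ((index u s < index v s) == odd (index u s + index v s))).
  exact: orientation_index.
move=> M MA modM.
have [x xA] : exists x, x \in A.
  by apply/card_gt0P; case/orP: A35 => /eqP->.
have sz : size (enum A) = #|A| by rewrite -cardE.
pose f i := nth x (enum A) i.
have fA i : i < #|A| -> f i \in A by move=> iA; rewrite -mem_enum mem_nth ?sz.
have idx i : i < #|A| -> index (f i) s = i.
  move=> iA; rewrite index_cat mem_enum fA // index_uniq ?enum_uniq //.
  by rewrite sz.
have fidx u : u \in A -> exists2 i, i < #|A| & u = f i.
  by rewrite -mem_enum => uA; exists (index u (enum A));
      rewrite /f ?nth_index // -sz index_mem.
case: (@circular_prime #|A| (fun i => f i \in M) A35).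
- apply/allP => i; rewrite mem_iota /= add0n => iA.
  apply/allP => j; rewrite mem_iota /= add0n => jA.
  apply/allP => k; rewrite mem_iota /= add0n => kA.
  apply/implyP => /and3P[iM jM kM]; have [+ _] := modM _ _ _ iM jM (fA k kA) kM.
  rewrite !idx // !cA ?fA //= ; last first.
  + by apply: contraNneq kM => ->.
  + by apply: contraNneq kM => ->.
  by move=> ->.
- move=> /allP h; right; apply/eqP; rewrite eqEsubset MA; apply/subsetP => u.
  by case/fidx => i iA ->; apply: h; rewrite mem_iota.
move=> h; left; apply/card_le1_eqP => u v uM vM.
have [i iA eu] := fidx u (subsetP MA u uM).
have [j jA ev] := fidx v (subsetP MA v vM).
by rewrite eu ev (h i j) ?mem_iota // -?eu -?ev.
Qed.

(** * Sufficiency: the induction *)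

Lemma prime_orientation_exists A : 3 <= #|A| -> conn A -> twin_bounded A ->
    ~ (complete A /\ #|A| = 4) ->
  exists2 arc : rel G, orientation arc & prime_in A arc.
Proof.
have [n] := ubnP #|A|; elim: n A => // n IHn A leAn A3 cA tA nK4.
have IH x : x \in A -> 3 < #|A| -> conn (A :\ x) -> twin_bounded (A :\ x) ->
    ~ (complete (A :\ x) /\ #|A :\ x| = 4) ->
    exists2 arc : rel G, orientation arc & prime_in A arc.
  move=> xA A4 cAx tAx nK4x; have eA := cardsD1 x A; rewrite xA add1n in eA.
  have [|||||arc oarc parc] := IHn (A :\ x) => //; try by lia.
  by apply: (prime_extend cA tA xA _ _ oarc parc); [lia|right].
have [/forall_inP cplA|] := boolP [forall u in A, forall v in A, (u != v) ==> (u -- v)].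
  have {}cplA : complete A.
    by move=> u v uA vA uv; have /forall_inP/(_ v vA) := cplA u uA; rewrite uv.
  have [small|] := boolP ((#|A| == 3) || (#|A| == 5)).
    exact: prime_complete_small.
  rewrite negb_or => /andP[A3' A5'].
  have A4' : #|A| != 4 by apply/eqP => A4; apply: nK4.
  (* Now [A] has at least six vertices, so deleting one cannot leave the excluded complete graph on
     four. *)
  have [x xA] : exists x, x \in A by apply/card_gt0P; lia.
  have cplAx : complete (A :\ x) by apply: complete_sub cplA; apply: subD1set.
  apply: (IH x) => //; first by lia.
  - exact: complete_conn.
  - exact: complete_twin_bounded.
  by case=> _; have := cardsD1 x A; rewrite xA; lia.
case/forall_inPn => a aA /forall_inPn[c ccA]; rewrite negb_imply => /andP[ac nac].
have [A3'|A4] := eqVneq #|A| 3.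
  (* Any orientation would do here: [A :\ a] has two vertices, and [c] shows that [a] is not
     universal. *)
  pose s := enum G; have ss u : u \in s by rewrite mem_enum.
  apply: (prime_extend cA tA aA _ _ (orientation_index ss)); first by lia.
    by left; exists c; rewrite // !inE eq_sym ac.
  move=> M MA _; have := subset_leq_card MA.
  have e2 : #|A :\ a| = 2 by have := cardsD1 a A; rewrite aA; lia.
  have [leM1|ltM1 _] := leqP #|M| 1; first by left.
  by right; apply/eqP; rewrite eqEcard MA e2.
have {}A4 : 3 < #|A| by lia.
have [v [vA cv ncv]] := noncut_vertex cA A4 aA ccA ac nac.
(* Since [A :\ v] is connected and not complete, only its twin classes remain to be bounded. *)
have small : (forall u, u \in A :\ v -> #|twins (A :\ v) u| <= 2) ->
    exists2 arc : rel G, orientation arc & prime_in A arc.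
  move=> h; apply: (IH v) => //; last by case.
  by apply: small_twin_bounded => //; have := cardsD1 v A; rewrite vA; lia.
pose x := [arg max_(u > a in A) #|twins A u|].
have [xA xmax] : x \in A /\ forall u, u \in A -> #|twins A u| <= #|twins A x|.
  by rewrite /x; case: arg_maxnP.
have [free|] := leqP #|twins A x| 1.
  apply: small => u uA; apply: twin_free_delete => w wA.
  exact: leq_trans (xmax w wA) free.
rewrite (cardsD1 x) inE xA eqxx ltnS => /card_gt0P[y /setD1P[yx yT]].
(* Deleting [x] could leave the complete graph on four vertices; whenever [A :\ x] is complete, [v]
   is deleted instead. *)
have [/forall_inP cplA|ncplA] :=
  boolP [forall u in A :\ x, forall v in A :\ x, (u != v) ==> (u -- v)].
  apply: small => u uA; apply: (@near_complete_delete _ x).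
  by move=> p q pA qA pq; have /forall_inP/(_ q qA) := cplA p pA; rewrite pq.
have [cx tx] := twins_delete cA tA xA yT yx xmax.
apply: (IH x) => //; case=> cplA _; case/negP: ncplA.
by apply/forall_inP => p pA; apply/forall_inP => q qA; apply/implyP; apply: cplA.
Qed.

(** * From vertex subsets to the whole graph *)

Lemma complete_isomorphic n : complete [set: G] -> #|G| = n ->
  isomorphic G (complete_graph n).
Proof.
move=> cG eG; exists (fun x => cast_ord eG (enum_rank x)).
  exists (fun i => enum_val (cast_ord (esym eG) i)) => [x|i].
    by rewrite cast_ordK enum_rankK.
  by rewrite enum_valK cast_ordKV.
move=> x y; rewrite /= (inj_eq (@cast_ord_inj _ _ _)) (inj_eq enum_rank_inj).
by apply/idP/idP => [|/adj_neq //]; apply: cG; rewrite inE.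
Qed.

Lemma connected_conn : connected G -> conn [set: G].
Proof.
move=> cG C a b _ _ aC bC.
have [/existsP[u /existsP[v /and3P[uC vC uv]]]|nex] :=
  boolP [exists u, exists v, [&& u \in C, v \notin C & u -- v]].
  by exists u, v; rewrite !inE.
have cross u v : u -- v -> u \in C -> v \in C.
  move=> uv uC; apply: contraNT nex => vC.
  by apply/existsP; exists u; apply/existsP; exists v; apply/and3P.
have clC : closed (@adj G) (mem C).
  by move=> u v uv; apply/idP/idP; apply: cross; rewrite // adjC.
by move: bC; rewrite -(closed_connect clC (cG a b)) aC.
Qed.

Lemma s_module_twin_bounded :
  (forall S : {set G}, s_module S -> #|S| <= 2 ^ degree S) ->
  twin_bounded [set: G].
Proof.
(* A class of one vertex is not a stable set, but [1 <= 2 ^ d] always holds. *)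
move=> hS x _; have [T1|T2] := leqP #|twins [set: G] x| 1.
  by apply: leq_trans T1 _; rewrite expn_gt0.
set T := twins _ _ in T2 *.
have TE u v : u \in T -> u -- v = x -- v.
  by rewrite !inE => /= /eqP/setP/(_ v); rewrite !inE.
have -> : nbhd [set: G] x = neighbourhood T.
  apply/setP => v; rewrite in_set in_setT [in RHS]in_set; apply/idP/andP => [/= xv|[_]].
    split; first by apply/negP => /(TE v x); rewrite adjxx adjC xv.
    by apply/existsP; exists x; rewrite adjC xv !inE eqxx.
  by case/exists_inP => u uT; rewrite adjC TE.
apply: hS; split; first by move=> u v w uT vT _; rewrite ![w -- _]adjC !TE.
by split=> // u v uT vT; rewrite (twins_nadj uT vT).
Qed.

Lemma prime_in_digraph arc : 3 <= #|G| -> prime_in [set: G] arc -> prime_digraph arc.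
Proof.
move=> G3 parc; split=> // M modM.
have modM' : dmodule_in [set: G] arc M by move=> u v w uM vM _; apply: modM.
have [M1|->] := parc M (subsetT M) modM'; last by right; left.
have [->|[x xM]] := set_0Vmem M; first by left.
right; right; exists x; apply/eqP; rewrite eq_sym eqEcard sub1set xM cards1.
exact: M1.
Qed.

(** * Necessity *)

Lemma closed_module arc C : orientation arc ->
  (forall u v, u -- v -> u \in C -> v \in C) -> digraph_module arc C.
Proof.
move=> oarc clC u v w uC vC wC.
have nadj z : z \in C -> z -- w = false by move=> zC; apply: contraNF wC => /clC; apply.
by rewrite !(orientationN oarc) // ?[w -- _]adjC nadj.
Qed.

(** The component of [x] and its complement are proper nonempty modules, hence singletons, which
    leaves only two vertices. *)
Lemma prime_connected (arc : rel G) : orientation arc -> prime_digraph arc -> connected G.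
Proof.
move=> oarc [G3 parc] x y; apply/negPn/negP => nxy.
pose C := [set z | connect (@adj G) x z].
have clC u v : u -- v -> u \in C -> v \in C.
  by move=> uv; rewrite !inE => xu; apply: connect_trans xu (connect1 uv).
have clD u v : u -- v -> u \in ~: C -> v \in ~: C.
  by move=> uv; rewrite !in_setC; apply: contra; apply: clC; rewrite adjC.
have xC : x \in C by rewrite inE.
have yD : y \in ~: C by rewrite !inE.
have small (D : {set G}) p q : p \in D -> q \notin D -> trivial_set D -> #|D| = 1.
  move=> pD qD [D0|[DT|[z ->]]]; last exact: cards1.
    by rewrite D0 inE in pD.
  by rewrite DT inE in qD.
have C1 : #|C| = 1.
  by apply: (small C x y) => //; [rewrite -in_setC|apply/parc/closed_module].
have D1 : #|~: C| = 1.
  by apply: (small _ y x) => //; [rewrite inE xC|apply/parc/closed_module].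
by have := cardsC C; rewrite C1 D1 => e; rewrite -e in G3.
Qed.

(** Pigeonhole on the sets of in-neighbours within the neighbourhood of [S]. Two vertices with equal
    sets also have equal out-neighbours there and no arcs elsewhere, so they form a nontrivial
    module. *)
Lemma prime_s_module_bound (arc : rel G) (S : {set G}) :
  orientation arc -> prime_digraph arc -> s_module S -> #|S| <= 2 ^ degree S.
Proof.
move=> oarc [G3 parc] [modS [_ stabS]].
rewrite /degree -card_powerset leqNgt; apply/negP => big.
pose f u := [set v in neighbourhood S | arc v u].
have /dinjectivePn[u uS [w /andP[wu wS] efuw]] : ~~ dinjectiveb f (mem S).
  apply: contraTN big => /dinjectiveP injf; rewrite -leqNgt.
  rewrite -(card_in_imset injf); apply/subset_leq_card/subsetP => _ /imsetP[z _ ->].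
  by rewrite inE; apply/subsetP => v; rewrite inE => /andP[].
have agree (v : G) : v \notin [set u; w] -> arc v u = arc v w /\ arc u v = arc w v.
  rewrite !inE negb_or => /andP[vu vw].
  have [vS|vS] := boolP (v \in S).
    by rewrite !(orientationN oarc) //; apply/negbTE/stabS.
  have e := modS u w v uS wS vS.
  have [vadj|nvadj] := boolP (v -- u); last first.
    by rewrite !(orientationN oarc) // ?[_ -- v]adjC -?e; apply/negbTE.
  have vN : v \in neighbourhood S.
    by rewrite inE vS; apply/exists_inP; exists u.
  have /setP/(_ v) := efuw; rewrite !inE in vN *; rewrite vN /= => e'.
  by rewrite !(orientation_sym oarc (u := v)) -?e // e'.
have modp : digraph_module arc [set u; w].
  move=> p q v pP qP /agree[e1 e2]; move: pP qP.
  by rewrite !in_set2 => /orP[]/eqP-> /orP[]/eqP->.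
have p2 : #|[set u; w]| = 2 by rewrite cards2 eq_sym wu.
case: (parc _ modp) => [e|[e|[z e]]]; move: p2; rewrite e ?cards0 ?cards1 //.
by rewrite cardsT => e'; rewrite e' in G3.
Qed.

End InducedSubgraphs.

(** * The logarithmic form of the bound *)

Import Rdefinitions.
Import Reals Lra.

(** Both sides compare [ln s] with [d * ln 2], the logarithm of [2 ^ d], and [ln] is strictly
    increasing. *)
Lemma log2_le_INR d s : 0 < s ->
  (INR d >= log2 (INR s))%R <-> s <= expn 2 d.
Proof.
move=> s0; have ln2 : (0 < ln 2)%R by rewrite -ln_1; apply: ln_increasing; lra.
have s0R : (0 < INR s)%R by apply: (lt_INR 0); apply/ltP.
have p2 : INR (expn 2 d) = Rpower 2 (INR d).
  rewrite Rpower_pow; last lra.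
  by elim: d => //= d IHd; rewrite expnS mult_INR IHd.
have lnp : ln (INR (expn 2 d)) = (INR d * ln 2)%R by rewrite p2 ln_exp.
have pos : (0 < INR (expn 2 d))%R by rewrite p2; apply: exp_pos.
have e : ((INR d >= log2 (INR s)) <-> (ln (INR s) <= ln (INR (expn 2 d))))%R.
  rewrite lnp /log2; split=> h.
    have -> : ln (INR s) = (ln (INR s) / ln 2 * ln 2)%R by field; lra.
    by apply: Rmult_le_compat_r; lra.
  apply: Rle_ge; apply: (Rmult_le_reg_r (ln 2)) => //.
  by have -> : (ln (INR s) / ln 2 * ln 2 = ln (INR s))%R by field; lra.
split=> [/e h|h].
  apply/leP/INR_le; case: (Rle_lt_dec (INR s) (INR (expn 2 d))) => // lt.
  by have := ln_increasing _ _ pos lt; lra.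
apply/e; case: (le_INR _ _ (elimT leP h)) => [lt|->]; last exact: Rle_refl.
by left; apply: ln_increasing.
Qed.

Theorem theorem1 (G : sgraph)
    (card_G : 3 <= #|G|)
    (not_K4 : ~ isomorphic G (complete_graph 4)) :
  primarily_orientable G <->
  connected G /\
  (forall S : {set G}, s_module S ->
     (Raxioms.INR (degree S) >= log2 (Raxioms.INR #|S|))%R).
Proof.
have pos (S : {set G}) : s_module S -> 0 < #|S| by move=> [_ [/ltnW]].
split=> [[arc oarc parc]|[cG hS]].
  split=> [|S sS]; first exact: prime_connected oarc parc.
  by apply/log2_le_INR; [apply: pos|apply: prime_s_module_bound oarc parc sS].
have [||||arc oarc parc] := @prime_orientation_exists G [set: G].
- by rewrite cardsT.
- exact: connected_conn.
- by apply: s_module_twin_bounded => S sS; apply/log2_le_INR; [apply: pos|apply: hS].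
- by rewrite cardsT => -[cplG G4]; apply/not_K4/complete_isomorphic.
by exists arc => //; apply: prime_in_digraph.
Qed.
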